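(* Let $K$ be a field and let $\Delta$ be a pure simplicial complex of dimension $d-1$ with vertex set $V$. Then for all positive integers $k$ and $t$ with $t\le d-1$, the following are equivalent: (i) $\Delta$ is $k$-$\mathrm{CM}_t$ over $K$; (ii) for every non-empty face $\sigma$ of $\Delta$, the link $\mathrm{lk}_\Delta(\sigma)$ is $k$-$\mathrm{CM}_{t-1}$ over $K$.
   Context: Simplicial complexes are finite and contain the empty face $\varnothing$; the vertex set of $\Delta$ is $\{x:\{x\}\in\Delta\}$; $\#\sigma$ is the number of elements of a face $\sigma$, and $\dim\sigma=\#\sigma-1$ (so $\dim\{\varnothing\}=-1$). A complex is pure if all its facets have the same dimension. For $\sigma\in\Delta$, $\mathrm{lk}_\Delta(\sigma)=\{\tau\in\Delta : \tau\cup\sigma\in\Delta,\ \tau\cap\sigma=\varnothing\}$. A complex is Cohen-Macaulay over $K$ if its Stanley-Reisner ring over $K$ is Cohen-Macaulay; $\{\varnothing\}$ is Cohen-Macaulay. Definition: for an integer $t\ge 0$, a simplicial complex $\Delta$ is $\mathrm{CM}_t$ over $K$ if $\Delta$ is pure and $\mathrm{lk}_\Delta(\sigma)$ is Cohen-Macaulay over $K$ for every $\sigma\in\Delta$ with $\#\sigma\ge t$; for $t\le 0$, $\mathrm{CM}_t$ means $\mathrm{CM}_0$ (which is Cohen-Macaulayness). For $W\subseteq V$ write $\Delta_{V\setminus W}=\{\sigma\in\Delta:\sigma\subseteq V\setminus W\}$. Definition: for a positive integer $k$, a simplicial complex $\Delta$ with vertex set $V$ is $k$-$\mathrm{CM}_t$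 of dimension $r$ over $K$ if for every subset $W\subseteq V$ (including $\varnothing$) with $\#W<k$, the complex $\Delta_{V\setminus W}$ is $\mathrm{CM}_t$ over $K$ of dimension $r$; it is $k$-$\mathrm{CM}_t$ over $K$ if this holds for some $r$. For a link, its own vertex set is used. *)

(* Defs.v *)
From HB Require Import structures.
From mathcomp Require Import all_boot all_order all_algebra ring_quotient.
From mathcomp Require Import mpoly.
From mathcomp Require Import boolp.

Set Implicit Arguments.
Unset Strict Implicit.
Unset Printing Implicit Defensive.

Import GRing.Theory.
Local Open Scope ring_scope.

(* In this section ideals are [{pred R}]: by the axioms of [boolp], every
   [Prop]-valued predicate is the truth of a boolean one, so that quantifying
   over [{pred R}] is quantifying over all subsets of [R].  Note that the
   library's [idealr_closed] includes properness. *)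
Section CohenMacaulayRings.
Variable R : comNzRingType.

Definition ideal_gen (s : seq R) (x : R) : Prop :=
  exists c : 'I_(size s) -> R, x = \sum_(i < size s) c i * s`_i.

Definition noetherian : Prop :=
  forall I : {pred R}, idealr_closed I ->
    exists s : seq R, forall x, x \in I <-> ideal_gen s x.

Definition prime_ideal (P : {pred R}) : Prop :=
  idealr_closed P /\ prime_idealr_closed P.

Definition maximal_ideal (M : {pred R}) : Prop :=
  idealr_closed M /\
  forall I : {pred R}, idealr_closed I -> {subset M <= I} -> {subset I <= M}.

(* s_i is a nonzerodivisor on R / (s_0, ..., s_(i-1)), and R / (s) != 0. *)
Definition regular_sequence (s : seq R) : Prop :=
  (forall (i : nat) (a : R), (i < size s)%N ->
     ideal_gen (take i s) (a * s`_i) -> ideal_gen (take i s) a)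
  /\ ~ ideal_gen s 1.

Definition regular_sequence_in (I : {pred R}) (s : seq R) : Prop :=
  regular_sequence s /\ {subset s <= I}.

(* depth(I, R) = n *)
Definition has_depth (I : {pred R}) (n : nat) : Prop :=
  (exists2 s : seq R, regular_sequence_in I s & size s = n) /\
  (forall s : seq R, regular_sequence_in I s -> (size s <= n)%N).

Definition prime_chain (P : {pred R}) (n : nat) (Q : nat -> {pred R}) : Prop :=
  [/\ forall i, (i <= n)%N -> prime_ideal (Q i),
      forall i, (i < n)%N ->
        {subset Q i <= Q i.+1} /\ ~ {subset Q i.+1 <= Q i}
    & Q n =i P].

(* codim P = n, i.e. P has height n *)
Definition has_height (P : {pred R}) (n : nat) : Prop :=
  (exists Q, prime_chain P n Q) /\
  (forall m Q, prime_chain P m Q -> (m <= n)%N).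

(* Eisenbud's definition (Commutative Algebra, Section 18.2): the depth of
   every maximal ideal equals its codimension.  For a maximal ideal M,
   depth(M, R) is the depth of the local ring R_M, and codim M its Krull
   dimension. *)
Definition cohen_macaulay_ring : Prop :=
  noetherian /\
  forall M : {pred R}, maximal_ideal M ->
    exists2 n : nat, has_depth M n & has_height M n.

End CohenMacaulayRings.

Section Complexes.
Variable T : finType.

Definition is_complex (D : {set {set T}}) : bool :=
  (set0 \in D) &&
  [forall s in D, forall t : {set T}, (t \subset s) ==> (t \in D)].

Record complex := Complex {
  faces :> {set {set T}};
  facesP : is_complex faces }.

HB.instance Definition _ := [isSub for faces].

Implicit Types (D : complex) (s t W : {set T}).

Lemma complex0 D : set0 \in D.
Proof. by have /andP[] := facesP D. Qed.

Lemma complexS D s t : t \subset s -> s \in D -> t \in D.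
Proof.
move=> ts sD; have /andP[_ /forall_inP/(_ s sD)/forallP/(_ t)] := facesP D.
by rewrite ts.
Qed.

Definition vertices D : {set T} := [set x | [set x] \in D].

Definition face_dim s : int := #|s|%:Z - 1.

Definition complex_dim D : int := (\max_(s in D) #|s|)%N%:Z - 1.

Definition facet D s : bool := maxset [pred t | t \in D] s.

Definition pure D : Prop :=
  forall s t, facet D s -> facet D t -> face_dim s = face_dim t.

Definition link_faces D s : {set {set T}} :=
  [set t in D | (t :|: s \in D) && (t :&: s == set0)].

Lemma link_complex D s : s \in D -> is_complex (link_faces D s).
Proof.
move=> sD; apply/andP; split; first by rewrite inE complex0 set0U sD set0I /=.
apply/forall_inP => t; rewrite inE => /and3P[tD tsD /eqP ts0].
apply/forallP => u; apply/implyP => ut; rewrite inE (complexS ut tD).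
rewrite (complexS (setSU s ut) tsD) /= -subset0 -ts0; exact: setSI.
Qed.

(* Only the link of a face is a complex: otherwise it lacks the empty face. *)
Definition link D s (sD : s \in D) : complex := Complex (link_complex sD).

Definition deletion_faces D W : {set {set T}} :=
  [set s in D | s \subset vertices D :\: W].

Lemma deletion_complex D W : is_complex (deletion_faces D W).
Proof.
apply/andP; split; first by rewrite inE complex0 sub0set.
apply/forall_inP => t; rewrite inE => /andP[tD tW].
by apply/forallP => u; apply/implyP => ut; rewrite inE (complexS ut tD)
  (subset_trans ut tW).
Qed.

Definition deletion D W : complex := Complex (deletion_complex D W).

End Complexes.

Section StanleyReisner.
Variables (K : fieldType) (T : finType).
Implicit Types (D : complex T) (F W : {set T}).

(* The variable 'X_i stands for the i-th vertex of D. *)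
Definition sr_monomial D F : {mpoly K[#|vertices D|]} :=
  \prod_(i < #|vertices D| | enum_val i \in F) 'X_i.

Definition sr_generators D : seq {mpoly K[#|vertices D|]} :=
  [seq sr_monomial D F
     | F in [set F : {set T} | (F \subset vertices D) && (F \notin D)]].

Definition sr_ideal D : {pred {mpoly K[#|vertices D|]}} :=
  fun p => `[< ideal_gen (sr_generators D) p >].
Arguments sr_ideal : clear implicits.

Lemma sr_generators_eval0 D p :
  p \in sr_generators D -> p.@[fun=> 0] = 0.
Proof.
case/imageP => F; rewrite inE => /andP[FV FD] ->.
have /set0Pn[x xF] : F != set0 by apply: contraNneq FD => ->; exact: complex0.
have xV := subsetP FV x xF.
rewrite /sr_monomial (bigD1 (enum_rank_in xV x)) ?enum_rankK_in //=.
by rewrite mevalM mevalXU mul0r.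
Qed.

Lemma sr_idealr_closed D : idealr_closed (sr_ideal D).
Proof.
split.
- apply/asboolP; exists (fun=> 0).
  by rewrite big1 // => i _; rewrite mul0r.
- apply/asboolP => -[c] /(congr1 (meval (fun=> 0))).
  rewrite meval1 raddf_sum /= big1 => [/eqP|i _]; first by rewrite oner_eq0.
  rewrite mevalM [X in _ * X]sr_generators_eval0 ?mulr0 //.
  exact: mem_nth.
- move=> a u v /asboolP[c ->] /asboolP[d ->].
  apply/asboolP; exists (fun i => a * c i + d i).
  rewrite mulr_sumr -big_split /=; apply: eq_bigr => i _.
  by rewrite mulrDl mulrA.
Qed.

HB.instance Definition _ D := isIdealr.Build _ (sr_ideal D) (sr_idealr_closed D).

Definition stanley_reisner_ring D : comNzRingType := {ideal_quot (sr_ideal D)}.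

Definition cohen_macaulay D : Prop :=
  cohen_macaulay_ring (stanley_reisner_ring D).

Definition CM (t : nat) D : Prop :=
  pure D /\
  forall (s : {set T}) (sD : s \in D), (t <= #|s|)%N -> cohen_macaulay (link sD).

Definition kCM_of_dim (k t : nat) (r : int) D : Prop :=
  forall W, W \subset vertices D -> (#|W| < k)%N ->
    CM t (deletion D W) /\ complex_dim (deletion D W) = r.

Definition kCM (k t : nat) D : Prop := exists r : int, kCM_of_dim k t r D.

End StanleyReisner.

(* Main.v *)
(* Everything is combinatorial: links and deletions commute, a link in a link
   is a link, and so Cohen-Macaulayness is only transported along equalities of
   complexes.  From links back to D, a face of size at least t > 0 and a facet
   of D minus W are both handled in the link of one of their vertices; the only
   other case is that the facet is empty, i.e. that W contains all vertices.
   Then deleting W, which has fewer than k elements, from the link of a vertex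
   leaves the empty face alone, although the dimension should remain
   d - 2 >= 0. *)
Require Import Defs.
From mathcomp Require Import all_boot all_order all_algebra.

Set Implicit Arguments.
Unset Strict Implicit.
Unset Printing Implicit Defensive.

Local Open Scope ring_scope.

Section ComplexTheory.
Variable T : finType.
Implicit Types (D E : complex T) (s t u W : {set T}).

Lemma setDUK s t : s \subset t -> t :\: s :|: s = t.
Proof. by move=> st; rewrite -{2}(setID t s) (setIidPr st) setUC. Qed.

Lemma disjoint_setD s t : [disjoint t :\: s & s].
Proof. by rewrite -setI_eq0 setDE -setIA (setIC _ s) setICr setI0. Qed.

Lemma eq_complex D E : D =i E -> D = E.
Proof. by move=> DE; apply/val_inj/setP. Qed.

Lemma face_vertices D s : s \in D -> s \subset vertices D.
Proof.
move=> sD; apply/subsetP => x xs; rewrite inE.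
by apply: complexS sD; rewrite sub1set.
Qed.

Lemma in_deletion D W s : (s \in deletion D W) = (s \in D) && [disjoint s & W].
Proof.
rewrite inE subsetD; case sD: (s \in D) => //=.
by rewrite face_vertices.
Qed.

Lemma in_link D s (sD : s \in D) t :
  (t \in link sD) = (t :|: s \in D) && [disjoint t & s].
Proof.
rewrite inE setI_eq0; case tsD: (_ :|: _ \in D); rewrite ?andbF //=.
by rewrite (complexS (subsetUl t s) tsD).
Qed.

(** Faces contain only vertices, so deleting the other elements of [W] changes nothing. This cuts an
    arbitrary [W] down to one that the definition of [kCM] admits. *)
Lemma deletionIv D W : deletion D (W :&: vertices D) = deletion D W.
Proof.
apply: eq_complex => s; rewrite !in_deletion; case sD: (s \in D) => //=.
rewrite -!setI_eq0 (setIC W) setIA.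
by have /setIidPl -> := face_vertices sD.
Qed.

Lemma deletion_link D W s (sD : s \in D) (sDW : s \in deletion D W) :
  deletion (link sD) (W :&: vertices (link sD)) = link sDW.
Proof.
rewrite deletionIv; apply: eq_complex => t.
rewrite in_deletion !in_link in_deletion.
move: (sDW); rewrite in_deletion => /andP[_ sW].
by rewrite -!setI_eq0 setIUl setU_eq0 !setI_eq0 sW andbT andbAC.
Qed.

Lemma link_link D s u (sD : s \in D) (us : u \in link sD)
    (usD : u :|: s \in D) : link us = link usD.
Proof.
apply: eq_complex => t; rewrite !in_link setUA.
rewrite -!setI_eq0 setIUl setIUr !setU_eq0 !setI_eq0.
move: us; rewrite in_link => /andP[_ ->]; rewrite andbT.
by rewrite -andbA [X in _ && X]andbC.
Qed.

(** The type of the membership proof inside [link] depends on the face, so equal faces cannot simply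
    be rewritten there. *)
Lemma eq_link D s t (sD : s \in D) (tD : t \in D) : s = t -> link sD = link tD.
Proof. by move=> st; apply: eq_complex => u; rewrite !in_link st. Qed.

Lemma facetP D s :
  reflect (s \in D /\ forall t, t \in D -> s \subset t -> t = s) (facet D s).
Proof. exact: maxsetP. Qed.

Lemma facet_exists D s : s \in D -> exists2 t, facet D t & s \subset t.
Proof.
move=> sD; have [t tD st] := @maxset_exists _ [pred t | t \in D] _ sD.
by exists t.
Qed.

(** Removing [s] from a face of [D] that contains [u :|: s] gives a face of the link that contains
    [u], so maximality carries over. *)
Lemma link_facet D s (sD : s \in D) u :
  facet (link sD) u -> facet D (u :|: s) /\ [disjoint u & s].
Proof.
case/facetP; rewrite in_link => /andP[usD us] umax; split=> //.
apply/facetP; split=> // t tD; rewrite subUset => /andP[ut st].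
rewrite -(umax (t :\: s)) ?setDUK //.
  by rewrite in_link setDUK ?tD ?disjoint_setD.
by rewrite subsetD ut.
Qed.

Lemma facet_link D s (sD : s \in D) t :
  facet D t -> s \subset t -> facet (link sD) (t :\: s).
Proof.
case/facetP => tD tmax st.
apply/facetP; split=> [|u]; first by rewrite in_link setDUK ?tD ?disjoint_setD.
rewrite in_link => /andP[usD us] tsu.
have uE : u :|: s = t by apply: tmax; rewrite // -(setDUK st) setSU.
by rewrite -uE setDUl setDv setU0; apply/esym/setDidPl.
Qed.

Lemma card_link_facet D s (sD : s \in D) (n : nat) :
  (forall t, facet D t -> #|t| = n) ->
  forall u, facet (link sD) u -> #|u| = (n - #|s|)%N.
Proof.
move=> Dn u /link_facet[/Dn <-]; rewrite -setI_eq0 => /eqP us.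
by rewrite cardsU us cards0 subn0 addnK.
Qed.

(** A face of maximal size is a facet, so purity and dimension together fix one common facet size, a
    natural number even in dimension -1. *)
Lemma pure_dimP D (n : nat) :
  pure D /\ complex_dim D = n%:Z - 1 <-> (forall s, facet D s -> #|s| = n).
Proof.
have [s sD smax] : {s | s \in D & \max_(t in D) #|t| = #|s|}%N.
  apply: (@eq_bigmax_cond _ (mem D) (fun t => #|t|)).
  by apply/card_gt0P; exists set0; apply: complex0.
have sF : facet D s.
  apply/facetP; split=> // t tD st; apply/eqP; rewrite eq_sym eqEcard st -smax.
  exact: (@leq_bigmax_cond _ (mem D) (fun t => #|t|)).
rewrite /complex_dim smax; split=> [[pD /GRing.addIr[<-]] u uF | Dn].
  by have /GRing.addIr[] := pD _ _ uF sF.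
by split; [move=> u v /Dn un /Dn vn; rewrite /face_dim un vn | rewrite Dn].
Qed.

Lemma vertices_link_disjoint D s (sD : s \in D) : [disjoint s & vertices (link sD)].
Proof.
rewrite disjoint_sym disjoint_subset; apply/subsetP => x.
by rewrite inE in_link disjoints1 => /andP[].
Qed.

Lemma vertices_link_sub D s (sD : s \in D) : vertices (link sD) \subset vertices D.
Proof. by apply/subsetP => x; rewrite !inE => /andP[]. Qed.

End ComplexTheory.

Section KCM.
Variables (K : fieldType) (T : finType).
Implicit Types (D : complex T) (s W : {set T}).

Lemma kCMP D k t :
  kCM K k t D <->
  exists n : nat, forall W, W \subset vertices D -> (#|W| < k)%N ->
    (forall s, facet (deletion D W) s -> #|s| = n) /\
    (forall s (sDW : s \in deletion D W), (t <= #|s|)%N ->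
       cohen_macaulay K (link sDW)).
Proof.
split=> [[r Dr] | [n Dn]]; last first.
  exists (n%:Z - 1) => W WV Wk; have [/pure_dimP[pDW dDW] cDW] := Dn W WV Wk.
  by split.
(* For [k = 0] no [W] is admissible, and any [n] serves. *)
have [k0 | k_gt0] := posnP k; first by exists 0%N => W _; rewrite k0.
have [_ r0] := Dr set0 (sub0set _) (eq_ind_r (fun i => i < k)%N k_gt0 (cards0 T)).
(* This is [r + 1], read off at the empty [W]. *)
exists (\max_(s in deletion D set0) #|s|)%N => W WV Wk.
have [[pDW cDW] dDW] := Dr W WV Wk; split=> //.
by apply/pure_dimP; split; rewrite // dDW -r0.
Qed.

(** A set of vertices of the link misses [s], so [s] survives its deletion from [D], and the link of
    [s] there is the deletion from the link. *)
Lemma kCM_link D k t s (sD : s \in D) :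
  s != set0 -> kCM K k t D -> kCM K k t.-1 (link sD).
Proof.
rewrite -card_gt0 => s_gt0 /kCMP[n Dn]; apply/kCMP; exists (n - #|s|)%N => W WV Wk.
have sDW : s \in deletion D W.
  by rewrite in_deletion sD (disjointWr WV) ?vertices_link_disjoint.
have [DWn cDW] := Dn W (subset_trans WV (vertices_link_sub sD)) Wk.
rewrite -[W](setIidPl WV) (deletion_link sD sDW).
split=> [u|u uL tu]; first exact: card_link_facet.
have /andP[usD us] : (u :|: s \in deletion D W) && [disjoint u & s].
  by rewrite -in_link.
rewrite (link_link uL usD); apply: cDW.
move: us; rewrite -setI_eq0 => /eqP us.
(* The non-empty [s] adds at least one element to the [t.-1] of [u]; this gives [t], also when
   [t = 0]. *)
rewrite cardsU us cards0 subn0; apply: leq_trans (leqSpred t) _.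
by rewrite -addn1 leq_add.
Qed.

(** Links of vertices suffice, since every non-empty face contains a vertex. *)
Lemma links_kCM D (d k t : nat) :
  (1 < d)%N -> (forall s, facet D s -> #|s| = d) -> (0 < k)%N -> (0 < t)%N ->
  (forall x (xD : [set x] \in D), kCM K k t.-1 (link xD)) -> kCM K k t D.
Proof.
move=> d_gt1 Dd k_gt0 t_gt0 linkD.
have linkW x (xD : [set x] \in D) W (Wk : (#|W| < k)%N) :
    (forall s, facet (deletion (link xD) (W :&: vertices (link xD))) s ->
       #|s| = d.-1) /\
    (forall s (sL : s \in deletion (link xD) (W :&: vertices (link xD))),
       (t.-1 <= #|s|)%N -> cohen_macaulay K (link sL)).
  have /kCMP[n Ln] := linkD x xD.
  have W'k : (#|W :&: vertices (link xD)| < k)%N.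
    exact: leq_ltn_trans (subset_leq_card (subsetIl _ _)) Wk.
  suff <- : n = d.-1 by apply: Ln; rewrite ?subsetIr.
  (* The size [n] is found by deleting nothing: a facet of the link is a facet of [D] through [x]
     with [x] removed. *)
  have [L0 _] := Ln set0 (sub0set _) (eq_ind_r (fun i => i < k)%N k_gt0 (cards0 T)).
  have [u uF _] := facet_exists (complex0 (link xD)).
  rewrite -subn1 -(cards1 x) -(card_link_facet Dd uF).
  apply/esym/L0; move: uF; congr facet; congr faces.
  by apply: eq_complex => s; rewrite in_deletion -setI_eq0 setI0 eqxx andbT.
apply/kCMP; exists d => W WV Wk; split=> [s sF | s sDW ts].
  have /facetP[sDW smax] := sF.
  have [s0 | [x xs]] := set_0Vmem s; last first.
    have xDW : [set x] \in deletion D W by apply: complexS sDW; rewrite sub1set.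
    have xD : [set x] \in D by move: xDW; rewrite in_deletion => /andP[].
    have [Ld _] := linkW x xD W Wk.
    have : #|s :\ x| = d.-1.
      by apply: Ld; rewrite (deletion_link xD xDW) facet_link ?sub1set.
    by move=> sx; rewrite (cardsD1 x) xs sx; case: (d) d_gt1.
  (* The empty set is now a facet of the deletion; a vertex outside [W] would be a larger face. *)
  have WVE : vertices D \subset W.
    apply/subsetP => x; rewrite inE => xD; apply: contraT => xW.
    have : [set x] = set0.
      by rewrite -s0; apply: smax; rewrite ?s0 ?sub0set // in_deletion xD disjoints1.
    by move/setP/(_ x); rewrite !inE eqxx.
  have [F FF _] := facet_exists (complex0 D).
  have [x xF] : exists x, x \in F.
    by apply/card_gt0P; rewrite (Dd F FF) ltnW.
  have xD : [set x] \in D.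
    by have /facetP[FD _] := FF; apply: complexS FD; rewrite sub1set.
  have [Ld _] := linkW x xD W Wk.
  have LE : deletion (link xD) (W :&: vertices (link xD)) =i [set set0].
    move=> u; rewrite deletionIv in_deletion in_set1.
    apply/andP/eqP => [[uL uW] | ->]; last by rewrite complex0 -setI_eq0 set0I.
    apply/eqP; rewrite -subset0 -(eqP (_ : u :&: W == set0)) ?setI_eq0 //.
    rewrite subsetI subxx (subset_trans _ WVE) //.
    exact: subset_trans (face_vertices uL) (vertices_link_sub xD).
  (* The empty set is a facet of the link after deletion, so [d.-1 = 0], against [1 < d]. *)
  have : #|set0 : {set T}| = d.-1.
    apply: Ld; apply/facetP; rewrite LE set11; split=> // u.
    by rewrite LE => /set1P.
  by rewrite cards0; case: (d) d_gt1 => [|[]].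
(* The link of [s] is the link of [s :\ x], of size at least [t.-1], inside the link of [x]. *)
have /card_gt0P[x xs] := leq_trans t_gt0 ts.
have xDW : [set x] \in deletion D W by apply: complexS sDW; rewrite sub1set.
have xD : [set x] \in D by move: xDW; rewrite in_deletion => /andP[].
have [_] := linkW x xD W Wk; rewrite (deletion_link xD xDW) => cL.
have sE : s :\ x :|: [set x] = s by rewrite setDUK ?sub1set.
have sL : s :\ x \in link xDW by rewrite in_link sE sDW disjoint_setD.
have sDW' : s :\ x :|: [set x] \in deletion D W by rewrite sE.
rewrite -(eq_link sDW' sDW sE) -(link_link sL).
apply: cL; move: ts t_gt0; rewrite (cardsD1 x) xs.
by case: (t).
Qed.

End KCM.

Theorem proposition3p6 (K : fieldType) (T : finType) (D : complex T) (d : nat)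
    (pureD : pure D) (dimD : complex_dim D = d%:Z - 1) (k t : nat)
    (k_gt0 : (0 < k)%N) (t_gt0 : (0 < t)%N) (t_le : t%:Z <= d%:Z - 1) :
  kCM K k t D <->
  (forall (s : {set T}) (sD : s \in D), s != set0 -> kCM K k t.-1 (link sD)).
Proof.
split=> [DkCM s sD s0 | linkD]; first exact: kCM_link.
have d_gt1 : (1 < d)%N.
  (* The bounds [1 <= t] and [t <= d - 1] force [d] to be at least 2. *)
  move: t_le; rewrite Num.Theory.lerBrDr -PoszD lez_nat addn1.
  exact: leq_ltn_trans.
apply: (@links_kCM _ _ _ d) => // [|x xD]; first exact/pure_dimP.
apply: linkD; apply/set0Pn; exists x; exact: set11.
Qed.
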